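(* Let $G=(V,E)$ be a directed graph (two vertices may be joined by several edges) with a source and a target. For every vertex $v\in V$ let $[a^\rho_v,b^\rho_v]$ be the window of the monotone resource $\rho$, and for every edge $e\in E$ let $q^\rho_e$ be the consumption of $\rho$ on $e$, where $q^\rho_e>0$ for every edge $e\in E$. For every vertex $v$ let the bucket (step) size be the smallest consumption of $\rho$ over the edges incident to $v$, $$\Delta_v=\min\{\,q^\rho_e : e\in\delta(v)\,\},$$ where $\delta(v)$ is the set of edges into and out of $v$ that lie on some feasible path, and let the number of buckets at $v$ be $N_v=\lfloor (b^\rho_v-a^\rho_v)/\Delta_v\rfloor+1$. Then, under this choice of step sizes, the forward dependency graph on the buckets $\{f^v_n : v\in V,\ 0\le n\le N_v-1\}$ is acyclic, i.e. contains no directed cycle.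
   Context: Setting: the resource constrained shortest path problem on a directed graph $G=(V,E)$ with a source, a target and a set of resources; each resource has a consumption on every edge and a window at every vertex, and a path is feasible if its accumulated resources respect the windows. $\rho$ is a designated monotone resource (its accumulation is non-decreasing along every edge; it is moreover assumed strictly consumed on every edge, $q^\rho_e>0$). A label represents a partial path and stores its cost and resource accumulations; labels are extended one edge at a time. Buckets: bucket $n$ of vertex $v$, written $f^v_n$, is the half-open interval $[a^\rho_v+n\Delta_v,\ a^\rho_v+(n+1)\Delta_v)$ of values of $\rho$; a value $s\in[a^\rho_v,b^\rho_v]$ falls in bucket $\lfloor (s-a^\rho_v)/\Delta_v\rfloor$. Forward dependency graph: its vertices are the buckets $f^v_n$. A directed edge from a bucket $\beta$ to a bucket $\beta'$ means that $\beta$ must be processed before $\beta'$. The edges are: (1) intra-vertex edges $f^v_{n-1}\to f^v_n$ (each bucket depends on the previous bucket of the same vertex); (2) inter-vertex edges: for every edge $(x,y)\in E$ and every bucket $f^y_n$ of $y$, an edge $f^x_{\pi(x,y,n)}\to f^y_n$, where $\pi(x,y,n)$ is the last bucket of $x$ that can feed bucket $n$ of $y$ over $(x,y)$, i.e. the largest index $m$ with $a^\rho_x+m\,\Delta_x+q^\rho_{xy}<a^\rho_y+(n+1)\,\Delta_y$. If the resulting index is negative, the dependency is omitted; if it is at least $N_x$, the dependency is on the last bucket $f^x_{N_x-1}$ of $x$.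
   Formalization: Inter-vertex dependencies are taken only over edges lying on some feasible source-target path (with all edges of E the claim fails: low-consumption edges on no feasible path can form a cycle); where δ(v) is empty, Δ_v may be any positive number. *)

(* Defs.v *)
From HB Require Import structures.
From mathcomp Require Import all_boot all_order all_algebra.
From mathcomp Require Import boolp classical_sets reals.

Set Implicit Arguments.
Unset Strict Implicit.
Unset Printing Implicit Defensive.

Import Order.TTheory GRing.Theory Num.Theory.
Local Open Scope classical_set_scope.
Local Open Scope ring_scope.

(* Edges are objects of their own, so parallel edges and loops are allowed. *)
Record rcspp (R : realType) := Rcspp {
  vertex : finType;
  edge : finType;
  edge_tail : edge -> vertex;
  edge_head : edge -> vertex;
  source : vertex;
  target : vertex;
  resource : finType;
  rho : resource;
  consumption : resource -> edge -> R;
  lower : resource -> vertex -> R;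
  upper : resource -> vertex -> R;
  window_nonempty : forall r v, lower r v <= upper r v;
  (* A disposable resource may be discarded on arrival so as to reach the lower
     end of the window (e.g. waiting, for time windows). *)
  disposable : resource -> bool;
  (* The accumulations of the empty partial path at the source. *)
  initial : resource -> R
}.

Section Instance.
Variables (R : realType) (I : rcspp R).
Implicit Types (v : vertex I) (e : edge I).

Definition extend (s : resource I -> R) e (r : resource I) : R :=
  let t := s r + consumption r e in
  if disposable r then Num.max (lower r (edge_head e)) t else t.

(* [p] leads a label at [v] with accumulations [s] to the target, within the
   windows of all the vertices visited, [v] included. *)
Fixpoint feasible_from v (s : resource I -> R) (p : seq (edge I)) : bool :=
  [forall r, lower r v <= s r <= upper r v] &&
  match p with
  | [::] => v == target I
  | e :: p' => (edge_tail e == v) && feasible_from (edge_head e) (extend s e) p'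
  end.

Definition feasible (p : seq (edge I)) : bool :=
  feasible_from (source I) (@initial R I) p.

Definition feasible_edges : set (edge I) :=
  [set e | exists2 p, feasible p & e \in p].

Definition delta v : set (edge I) :=
  [set e | feasible_edges e /\ (edge_head e = v \/ edge_tail e = v)].

Definition is_minimum (A : set R) (x : R) : Prop := A x /\ lbound A x.

(* The minimum is undefined at a vertex that no feasible path uses; any positive
   step size is allowed there. *)
Definition is_step_size (D : vertex I -> R) : Prop :=
  forall v,
    (delta v !=set0 -> is_minimum (consumption (rho I) @` delta v) (D v)) /\
    (delta v = set0 -> 0 < D v).

Variable D : vertex I -> R.

(* [Num.truncn] is the floor, as a natural number, of a nonnegative number. *)
Definition nbuckets v : nat :=
  (Num.truncn ((upper (rho I) v - lower (rho I) v) / D v)).+1.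

Definition bucket : Type := {v : vertex I & 'I_(nbuckets v)}.

Definition bucket_vertex (b : bucket) : vertex I := tag b.
Definition bucket_index (b : bucket) : nat := tagged b.

(* Bucket n of v is the interval [bucket_start v n, bucket_start v (n + 1)[. *)
Definition bucket_start v (n : int) : R := lower (rho I) v + n%:~R * D v.

(* Bucket m of the tail of e can feed bucket n of its head over e. *)
Definition feeds e (m n : int) : Prop :=
  bucket_start (edge_tail e) m + consumption (rho I) e < bucket_start (edge_head e) (n + 1).

(* [m] is the index pi(x, y, n) for the edge e = (x, y); it may be negative, or
   exceed the last bucket of x. *)
Definition last_feeding e (n m : int) : Prop :=
  feeds e m n /\ forall m', feeds e m' n -> m' <= m.

Definition intra_dep (b b' : bucket) : Prop :=
  bucket_vertex b = bucket_vertex b' /\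
  (bucket_index b).+1 = bucket_index b'.

Definition inter_dep e (b b' : bucket) : Prop :=
  edge_tail e = bucket_vertex b /\ edge_head e = bucket_vertex b' /\
  exists m : int,
    [/\ last_feeding e (bucket_index b')%:Z m, 0 <= m &
        (bucket_index b)%:Z = Num.min m (nbuckets (edge_tail e)).-1%:Z].

(* The forward dependency graph of the graph with edge set [A]. The step sizes
   only bound the consumption of the edges in [feasible_edges], so this is the
   meaningful choice of [A]: two opposite edges on no feasible path, of small
   consumption compared to the step sizes of their ends, can produce a cycle. *)
Definition forward_dep (A : set (edge I)) (b b' : bucket) : Prop :=
  intra_dep b b' \/ exists2 e, A e & inter_dep e b b'.

End Instance.

Definition acyclic (T : Type) (dep : T -> T -> Prop) : Prop :=
  forall c : seq T, cycle (fun x y => `[< dep x y >]) c -> c = [::].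

(* Main.v *)
(** The left endpoint of a bucket is a strictly monotone potential on the
    dependency graph.  Along an edge [(x, y)] of consumption [q], the last
    feeding index [m] satisfies [a_x + m D_x + q < a_y + n D_y + D_y], and
    [D_y <= q] by the choice of the step size. *)
Require Import Defs.
From mathcomp Require Import all_boot all_order all_algebra.
From mathcomp Require Import boolp classical_sets reals.
From mathcomp Require Import lra.
Import Order.TTheory GRing.Theory Num.Theory.
Local Open Scope ring_scope.

(** A nonempty cycle through [x] maps to a strictly increasing path from [f x] back to [f x], so
    transitivity gives [f x < f x]. *)
Lemma acyclic_homo_lt (d : Order.disp_t) (O : porderType d) (T : Type)
    (dep : T -> T -> Prop) (f : T -> O) :
  (forall x y, dep x y -> (f x < f y)%O) -> acyclic dep.
Proof.
move=> f_lt [//|x p] /= dep_cycle.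
have : path <%O (f x) (map f (rcons p x)).
  rewrite path_map; apply: sub_path dep_cycle => y z /asboolP.
  exact: f_lt.
by move=> /(order_path_min lt_trans); rewrite map_rcons all_rcons ltxx.
Qed.

Section StepSize.
Context {R : realType} {I : rcspp R} {D : vertex I -> R}.
Hypothesis step_sizeD : is_step_size D.

Lemma step_size_gt0 (v : vertex I) :
  (forall e : edge I, 0 < consumption (rho I) e) -> 0 < D v.
Proof.
move=> consumption_gt0; have [minD D_gt0] := step_sizeD v.
(* When [delta v] is nonempty the minimum is attained, so [D v] is itself the consumption of some
   edge. *)
have [/D_gt0 //|/eqP/set0P/minD[[e _ <-] _]] := pselect (delta v = set0).
exact: consumption_gt0.
Qed.

(** An edge on a feasible path lies in [delta] of its own head, over which the step size there is a
    minimum. *)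
Lemma step_size_le_consumption (e : edge I) :
  feasible_edges e -> D (edge_head e) <= consumption (rho I) e.
Proof.
move=> feasible_e; have [minD _] := step_sizeD (edge_head e).
have delta_e : delta (edge_head e) e by split; [|left].
by have [_] := minD (ex_intro _ e delta_e); apply; exists e.
Qed.

End StepSize.

Section BucketStart.
Context {R : realType} {I : rcspp R} {D : vertex I -> R}.

Lemma bucket_startD1 (v : vertex I) (n : int) :
  bucket_start D v (n + 1) = bucket_start D v n + D v.
Proof. by rewrite /bucket_start intrD mulrDl mul1r addrA. Qed.

Lemma le_bucket_start (v : vertex I) (m n : int) :
  0 < D v -> m <= n -> bucket_start D v m <= bucket_start D v n.
Proof. by move=> D_gt0 le_mn; rewrite lerD2l ler_pM2r// ler_int. Qed.

Lemma feeds_bucket_start_lt (e : edge I) (m n : int) :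
  D (edge_head e) <= consumption (rho I) e -> feeds D e m n ->
  bucket_start D (edge_tail e) m < bucket_start D (edge_head e) n.
Proof. by rewrite /feeds bucket_startD1 => D_le lt_mn; lra. Qed.

Lemma forward_dep_bucket_start_lt (A : set (edge I)) (b b' : bucket D) :
  (forall v, 0 < D v) ->
  (forall e, A e -> D (edge_head e) <= consumption (rho I) e) ->
  forward_dep A b b' ->
  bucket_start D (bucket_vertex b) (bucket_index b)%:Z
    < bucket_start D (bucket_vertex b') (bucket_index b')%:Z.
Proof.
move=> D_gt0 D_le [[<- <-]|[e Ae [<- [<- [m [[feeds_m _] _ ->]]]]]].
  by rewrite -addn1 PoszD bucket_startD1 ltrDl.
(* The index of [b] is [m] capped at the last bucket of the tail; capping can only lower the left
   endpoint, so the strict bound at [m] carries over. *)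
apply: le_lt_trans (feeds_bucket_start_lt _ _ _ (D_le e Ae) feeds_m).
by apply: le_bucket_start => //; rewrite ge_min lexx.
Qed.

End BucketStart.

Theorem mainTheorem1 (R : realType) (I : rcspp R)
    (consumption_gt0 : forall e : edge I, 0 < consumption (rho I) e)
    (D : vertex I -> R) (step_sizeD : is_step_size D) :
  acyclic (@forward_dep R I D (@feasible_edges R I)).
Proof.
apply: (@acyclic_homo_lt _ R _ _
  (fun b => bucket_start D (bucket_vertex b) (bucket_index b)%:Z)).
move=> b b'; apply: forward_dep_bucket_start_lt => [v|e].
  exact: step_size_gt0.
exact: step_size_le_consumption.
Qed.
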